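(* Let $\pi$ be an $n$-qubit permutation gate that is semi-Clifford. Then there exist Clifford permutations $\phi_1,\phi_2$ and a mismatch-free product $\mu$ of multi-controlled NOT gates such that $\pi=\phi_1\mu\phi_2$.
   Context: Gates on $n$ qubits are unitary operators on $(\mathbb{C}^2)^{\otimes n}$, with computational basis $\{|v\rangle : v\in\mathbb{F}_2^n\}$. The Pauli group $\mathcal{P}_n$ consists of all $cP_1\otimes\cdots\otimes P_n$ with $c\in\{\pm1,\pm i\}$ and $P_j\in\{I_2,X,Y,Z\}$. The Clifford group $\mathcal{C}_2$ is the set of unitaries $U$ with $UPU^\dagger\in\mathcal{P}_n$ for all $P\in\mathcal{P}_n$. A permutation gate is a unitary whose matrix in the computational basis is a permutation matrix; a Clifford permutation is a permutation gate in the Clifford group. A gate is semi-Clifford if it equals $\phi_1d\phi_2$ for some Clifford gates $\phi_1,\phi_2$ and some gate $d$ that is diagonal in the computational basis. A multi-controlled NOT gate (a $C^mX$ gate, for some $m\ge0$) has a target qubit $t$ and a set $K\subseteq[n]\setminus\{t\}$ of $m$ control qubits, and is the permutation gate replacing $a_t$ by $a_t+\prod_{i\in K}a_i$ and fixing the other coordinates (for $m=0$ it is $X_t$). A (possibly empty) product of such gates is mismatch-free if no qubit is used as a target by one gate and as a control by another gate of the product (equivalently, the gates pairwise commute). *)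

(* Defs.v *)
From HB Require Import structures.
From mathcomp Require Import all_boot all_order all_algebra.
From mathcomp Require Import reals complex.
Set Implicit Arguments.
Unset Strict Implicit.
Unset Printing Implicit Defensive.
Import Order.TTheory GRing.Theory Num.Theory.
Local Open Scope ring_scope.
Local Open Scope sesquilinear_scope.

Notation bits n := 'rV['F_2]_n.

(* Operators on n qubits, as matrices in the computational basis; the index of
   |v> is enum_rank v, so that rows and columns are read through enum_val. *)
Notation operator C n := 'M[C]_#|{: bits n}|.

Section Gates.
Variable C : numClosedFieldType.

Definition pauliX : 'M[C]_2 := \matrix_(i, j) (i != j)%:R.

Definition pauliZ : 'M[C]_2 :=
  \matrix_(i, j) (if i == j then (-1) ^+ i else 0).

(* Row 0 is (0, -i), row 1 is (i, 0). *)
Definition pauliY : 'M[C]_2 :=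
  \matrix_(i, j) (if i == j then 0 else if i == 0 then - 'i else 'i).

Section Qubits.
Variable n : nat.

Definition tensor (P : 'I_n -> 'M[C]_2) : operator C n :=
  \matrix_(i, j) \prod_(k < n) P k ((enum_val i : bits n) 0 k) ((enum_val j : bits n) 0 k).

Definition pauli_group (U : operator C n) : Prop :=
  exists (c : C) (P : 'I_n -> 'M[C]_2),
    [/\ c \in [:: 1; -1; 'i; - 'i],
        forall k, P k \in [:: 1%:M; pauliX; pauliY; pauliZ]
      & U = c *: tensor P].

Definition clifford (U : operator C n) : Prop :=
  U \is unitarymx /\
  (forall P : operator C n, pauli_group P -> pauli_group (U *m P *m U ^t*)).

Definition permutation_gate (U : operator C n) : Prop :=
  U \is unitarymx /\ is_perm_mx U.

Definition clifford_permutation (U : operator C n) : Prop :=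
  permutation_gate U /\ clifford U.

Definition diagonal_gate (U : operator C n) : Prop :=
  U \is unitarymx /\ is_diag_mx U.

Definition semi_clifford (U : operator C n) : Prop :=
  exists phi1 d phi2 : operator C n,
    [/\ clifford phi1, diagonal_gate d, clifford phi2
      & U = phi1 *m d *m phi2].

(* The operator |a> |-> |f a>. *)
Definition basis_map (f : bits n -> bits n) : operator C n :=
  \matrix_(i, j) ((enum_val i : bits n) == f (enum_val j))%:R.

(* In mcx_fun, mcx and in the pairs of a circuit below, t (first component) is
   the target and K (second component) is the set of controls; these describe
   a multi-controlled NOT gate when t \notin K. *)
Definition mcx_fun (t : 'I_n) (K : {set 'I_n}) (a : bits n) : bits n :=
  \row_j (if j == t then a 0 j + \prod_(i in K) a 0 i else a 0 j).

Definition mcx (t : 'I_n) (K : {set 'I_n}) : operator C n :=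
  basis_map (mcx_fun t K).

Definition mcx_circuit (s : seq ('I_n * {set 'I_n})) : Prop :=
  forall g, g \in s -> g.1 \notin g.2.

Definition mismatch_free (s : seq ('I_n * {set 'I_n})) : Prop :=
  forall g h, g \in s -> h \in s -> g.1 \notin h.2.

Definition mismatch_free_product (mu : operator C n) : Prop :=
  exists s : seq ('I_n * {set 'I_n}),
    [/\ mcx_circuit s, mismatch_free s
      & mu = \big[mulmx/1%:M]_(g <- s) mcx g.1 g.2].

End Qubits.
End Gates.

(* Main.v *)
Require Import Defs.
From HB Require Import structures.
From mathcomp Require Import all_boot all_order all_algebra.
From mathcomp Require Import fingroup perm reals complex.
From mathcomp Require Import ring.
Set Implicit Arguments.
Unset Strict Implicit.
Unset Printing Implicit Defensive.
Import Order.TTheory GRing.Theory Num.Theory.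
Local Open Scope ring_scope.
Local Open Scope sesquilinear_scope.

(** Let the permutation gate be |v> |-> |f v>.  Being semi-Clifford, it maps a
    Lagrangian subspace L of Paulis to Paulis.  Conjugating X^a Z^b by a
    permutation gate gives a Pauli only if f (v + a) = f v + a' for some a' and
    b.v = b'.(f v) + const for some b', so the X and Z parts of L can be treated
    separately.  Let B be the space of all b with Z^b in L.  By maximality of L,
    every a orthogonal to B is the X part of an element of L.  In coordinates
    where B is spanned by the first k coordinate forms, before and after f, the
    second condition says that f preserves the first k coordinates x, and the
    first one that f (x, y + a) = f (x, y) + T a with T linear.  Hence, up to
    affine bijections, f (x, y) = (x, y + h x), and expanding h in monomials
    gives multi-controlled NOT gates with controls in x and targets in y. *)

(** * Arithmetic of F_2 and the standard bilinear form on F_2^n *)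

Lemma F2_cases (x : 'F_2) : x = 0 \/ x = 1.
Proof. by case: x => [[|[|//]] ?]; [left | right]; apply: val_inj. Qed.

Lemma F2_addxx (x : 'F_2) : x + x = 0.
Proof. by case: (F2_cases x) => ->; apply: val_inj. Qed.

Definition dot n (b v : bits n) : 'F_2 := (b *m v^T) 0 0.

Lemma dotE n (b v : bits n) : dot b v = \sum_k b 0 k * v 0 k.
Proof. by rewrite /dot mxE; apply: eq_bigr => k _; rewrite mxE. Qed.

Lemma dotDl n (b c v : bits n) : dot (b + c) v = dot b v + dot c v.
Proof. by rewrite /dot mulmxDl mxE. Qed.

Lemma dotDr n (b v w : bits n) : dot b (v + w) = dot b v + dot b w.
Proof. by rewrite /dot linearD mulmxDr mxE. Qed.

Lemma dot0l n (v : bits n) : dot 0 v = 0.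
Proof. by rewrite /dot mul0mx mxE. Qed.

Lemma dot0r n (v : bits n) : dot v 0 = 0.
Proof. by rewrite /dot trmx0 mulmx0 mxE. Qed.

Lemma dotC n (v w : bits n) : dot v w = dot w v.
Proof. by rewrite !dotE; apply: eq_bigr => k _; rewrite mulrC. Qed.

Lemma dot_mull n m (v : bits n) (w : bits m) (A : 'M_(n, m)) :
  dot (v *m A) w = dot v (w *m A^T).
Proof. by rewrite /dot trmx_mul trmxK mulmxA. Qed.

Lemma dot_delta n (v : bits n) k : dot v (delta_mx 0 k) = v 0 k.
Proof.
rewrite dotE (bigD1 k) //= big1 => [|j jk]; rewrite mxE !eqxx ?mulr1 ?addr0 //.
by rewrite (negPf jk) mulr0.
Qed.

Lemma dot_inj n (b c : bits n) : (forall v, dot b v = dot c v) -> b = c.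
Proof. by move=> e; apply/rowP => k; rewrite -!dot_delta. Qed.

(** * Monomial operators, and Paulis in the form X^a Z^b *)

Section Monomial.
Variable C : numClosedFieldType.

Definition sgn (x : 'F_2) : C := (-1) ^+ x.

Lemma sgnD (x y : 'F_2) : sgn (x + y) = sgn x * sgn y.
Proof.
by case: (F2_cases x) => ->; case: (F2_cases y) => ->;
  rewrite /sgn /= ?expr0 ?expr1 ?mul1r ?mulr1 // mulrNN mulr1.
Qed.

Lemma sgn0 : sgn 0 = 1. Proof. by []. Qed.

Lemma sgn_neq0 x : sgn x != 0.
Proof. by rewrite expf_neq0 // oppr_eq0 oner_eq0. Qed.

Lemma sgn_inj : injective sgn.
Proof.
have /negPf N1 : (1 : C) != -1 by rewrite -addr_eq0 -mulr2n pnatr_eq0.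
move=> x y.
by case: (F2_cases x) => ->; case: (F2_cases y) => ->;
  rewrite /sgn /= ?expr0 ?expr1 // => /eqP; rewrite ?[-1 == _]eq_sym N1.
Qed.

Lemma sgn_expr4 x : sgn x ^+ 4 = 1.
Proof. by rewrite /sgn -exprM mulnC exprM -signr_odd /= expr0 expr1n. Qed.

(** Replaces the list of phases by a condition stable under products and quotients. *)
Lemma expr4_eq1 (c : C) : (c ^+ 4 == 1) = (c \in [:: 1; -1; 'i; - 'i]).
Proof.
have -> : (c ^+ 4 == 1) = ((c - 1) * (c + 1) * ((c - 'i) * (c + 'i)) == 0).
  rewrite -!subr_sqr sqrCi expr1n opprK -subr_sqr expr1n.
  by rewrite -exprM subr_eq0.
by rewrite !mulf_eq0 !subr_eq0 !addr_eq0 !inE !orbA.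
Qed.

Variable n : nat.
Implicit Types (f g : bits n -> bits n) (s t : bits n -> C) (a b : bits n) (c : C).

(* |v> |-> s v |f v> *)
Definition wmap f s : operator C n :=
  \matrix_(i, j) (((enum_val i : bits n) == f (enum_val j))%:R * s (enum_val j)).

Lemma eq_wmap f g s t : f =1 g -> s =1 t -> wmap f s = wmap g t.
Proof. by move=> fg st; apply/matrixP => i j; rewrite !mxE fg st. Qed.

Lemma wmap_mul f g s t :
  wmap f s *m wmap g t = wmap (f \o g) (fun v => s (g v) * t v).
Proof.
apply/matrixP => i j; rewrite !mxE (bigD1 (enum_rank (g (enum_val j)))) //=.
rewrite big1 ?addr0 => [|k kj]; rewrite !mxE ?enum_rankK ?eqxx ?mul1r ?mulrA //.
rewrite -(inj_eq enum_val_inj) enum_rankK in kj.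
by rewrite (negPf kj) mulr0 mul0r.
Qed.

Lemma wmap_inj f g s t : (forall v, s v != 0) -> wmap f s = wmap g t ->
  f =1 g /\ s =1 t.
Proof.
move=> s0 e; suff H v : f v = g v /\ s v = t v.
  by split=> v; case: (H v).
move/matrixP/(_ (enum_rank (f v)) (enum_rank v)): e.
rewrite !mxE !enum_rankK eqxx mul1r; case: eqP => [->|_]; rewrite ?mul1r //.
by rewrite mul0r => e; move: (s0 v); rewrite e eqxx.
Qed.

Lemma wmap_scale c f s : c *: wmap f s = wmap f (fun v => c * s v).
Proof. by apply/matrixP => i j; rewrite !mxE mulrCA. Qed.

Lemma wmap1 : wmap id (fun=> 1) = 1%:M.
Proof.
apply/matrixP => i j; rewrite !mxE mulr1 (inj_eq enum_val_inj) //.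
Qed.

Lemma basis_mapE f : basis_map C f = wmap f (fun=> 1).
Proof. by apply/matrixP => i j; rewrite !mxE mulr1. Qed.

Lemma basis_map_comp f g :
  basis_map C f *m basis_map C g = basis_map C (f \o g).
Proof. by rewrite !basis_mapE wmap_mul; apply: eq_wmap => // v; rewrite mulr1. Qed.

Lemma basis_map_adj f g : cancel f g -> cancel g f ->
  (basis_map C f)^t* = basis_map C g.
Proof.
move=> fK gK; apply/matrixP => i j; rewrite !mxE rmorph_nat.
by rewrite eq_sym (can2_eq fK gK).
Qed.

Lemma basis_map_perm f g : cancel f g -> cancel g f ->
  permutation_gate (basis_map C f).
Proof.
move=> fK gK; split.
  apply/unitarymxP; rewrite (basis_map_adj fK gK) basis_map_comp basis_mapE -wmap1.
  exact: eq_wmap.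
have inj_p : injective (fun i : 'I_#|{: bits n}| => enum_rank (g (enum_val i))).
  by move=> i j /(can_inj enum_rankK)/(congr1 f); rewrite !gK => /(can_inj enum_valK).
apply/is_perm_mxP; exists (perm inj_p); apply/matrixP => i j.
rewrite !mxE permE -(inj_eq enum_val_inj) enum_rankK.
by rewrite (can2_eq gK fK).
Qed.

Lemma permutation_gateP (U : operator C n) : permutation_gate U ->
  exists f g, [/\ cancel f g, cancel g f & U = basis_map C f].
Proof.
case=> _ /is_perm_mxP[p ->].
exists (fun v => enum_val ((p^-1)%g (enum_rank v))).
exists (fun v => enum_val (p (enum_rank v))).
split=> [v|v|]; rewrite ?enum_valK ?permKV ?permK ?enum_rankK //.
apply/matrixP => i j; rewrite !mxE enum_valK (inj_eq enum_val_inj).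
by rewrite (can2_eq (permK p) (permKV p)).
Qed.

(* c X^a Z^b *)
Definition pauli c a b := wmap (fun v => v + a) (fun v => c * sgn (dot b v)).

Lemma pauli_mul c a b c' a' b' :
  pauli c a b *m pauli c' a' b'
  = pauli (c * c' * sgn (dot b a')) (a + a') (b + b').
Proof.
rewrite /pauli wmap_mul; apply: eq_wmap => v /=; first by rewrite -addrA (addrC a).
by rewrite dotDr dotDl !sgnD; ring.
Qed.

Lemma pauli_scale k c a b : k *: pauli c a b = pauli (k * c) a b.
Proof. by rewrite wmap_scale; apply: eq_wmap => v //; rewrite mulrA. Qed.

Lemma pauli_inj c a b c' a' b' : c != 0 -> pauli c a b = pauli c' a' b' ->
  [/\ c = c', a = a' & b = b'].
Proof.
move=> c0 /wmap_inj[v|/(_ 0) ea es]; first by rewrite mulf_neq0 ?sgn_neq0.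
have ec : c = c' by move: (es 0); rewrite !dot0r sgn0 !mulr1.
split=> //; first by rewrite !add0r in ea.
by apply: dot_inj => v; apply: sgn_inj; apply: (mulfI c0); rewrite es ec.
Qed.

(** [sgn] is a character, so the signs of the single qubits multiply to the sign of the dot
    product. *)
Lemma tensor_pauli (P : 'I_n -> 'M[C]_2) (c : 'I_n -> C) a b :
  (forall k (x y : 'F_2),
     P k x y = (x == y + a 0 k)%:R * (c k * sgn (b 0 k * y))) ->
  tensor P = pauli (\prod_k c k) a b.
Proof.
move=> PE; apply/matrixP => i j; rewrite !mxE.
rewrite (eq_bigr _ (fun k _ => PE k _ _)).
rewrite big_split /= big_split /=; congr (_ * (_ * _)); last first.
  by rewrite dotE (big_morph sgn sgnD sgn0).
case: eqP => [->|ne]; first by apply: big1 => k _; rewrite !mxE eqxx.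
apply/eqP; rewrite prodf_seq_eq0; apply/hasP.
have /rV0Pn[k] : enum_val i - (enum_val j + a) != 0 by rewrite subr_eq0; apply/eqP.
rewrite !mxE subr_eq0 => /negPf kn; exists k; first by rewrite mem_index_enum.
by rewrite kn eqxx.
Qed.

(* The matrix of X^a Z^b up to the phase making it I, X, Y or Z. *)
Definition pauli1 (a b : 'F_2) : 'M[C]_2 :=
  if a == 0 then if b == 0 then 1%:M else pauliZ C
  else if b == 0 then pauliX C else pauliY C.

(** Accounts for Y = i X Z. *)
Definition phase1 (a b : 'F_2) : C := if (a == 1) && (b == 1) then 'i else 1.

Lemma pauli1E (a b x y : 'F_2) :
  pauli1 a b x y = (x == y + a)%:R * (phase1 a b * sgn (b * y)).
Proof.
case: (F2_cases a) => ->; case: (F2_cases b) => ->;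
case: (F2_cases x) => ->; case: (F2_cases y) => ->;
rewrite /pauli1 /phase1 /sgn /= !mxE /= ?expr0 ?expr1 ?mul0r ?mul1r ?mulr1 //.
all: by rewrite ?mulrN1.
Qed.

Lemma pauli1_ex (M : 'M[C]_2) : M \in [:: 1%:M; pauliX C; pauliY C; pauliZ C] ->
  exists ab, M = pauli1 ab.1 ab.2.
Proof.
rewrite !inE => /or4P[] /eqP ->;
  [exists (0, 0) | exists (1, 0) | exists (1, 1) | exists (0, 1)]; by [].
Qed.

Lemma phase_prod4 a b : (\prod_k phase1 (a 0 k) (b 0 k)) ^+ 4 = 1.
Proof.
rewrite -prodrXl big1 // => k _; rewrite /phase1; case: ifP => _; last exact: expr1n.
by rewrite -[4%N]/(2 * 2)%N exprM sqrCi sqrrN expr1n.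
Qed.

(** The phases by which tensors of I, X, Y, Z differ from X^a Z^b are fourth roots of unity, so they
    merge into the scalar. *)
Lemma pauli_groupP (U : operator C n) :
  pauli_group U <-> exists c a b, c ^+ 4 = 1 /\ U = pauli c a b.
Proof.
have T a b := @tensor_pauli (fun k => pauli1 (a 0 k) (b 0 k))
  (fun k => phase1 (a 0 k) (b 0 k)) a b (fun k => pauli1E (a 0 k) (b 0 k)).
split=> [[c [P [c4 PP ->]]]|[c [a [b [c4 ->]]]]].
  have /fin_all_exists[ab PE] k := pauli1_ex (PP k).
  exists (c * \prod_k phase1 (ab k).1 (ab k).2), (\row_k (ab k).1), (\row_k (ab k).2).
  have E : \prod_k phase1 (ab k).1 (ab k).2 =
      \prod_k phase1 ((\row_k (ab k).1) 0 k) ((\row_k (ab k).2) 0 k).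
    by apply: eq_bigr => k _; rewrite !mxE.
  split; first by rewrite exprMn E phase_prod4 mulr1; apply/eqP; rewrite expr4_eq1.
  rewrite -pauli_scale E -T; congr (_ *: _).
  apply/matrixP => i j; rewrite !mxE; apply: eq_bigr => k _.
  by rewrite !mxE PE.
pose ph := \prod_k phase1 (a 0 k) (b 0 k).
have ph4 : ph ^+ 4 = 1 by apply: phase_prod4.
have ph0 : ph != 0 by apply: contra_eq_neq ph4 => ->; rewrite expr0n eq_sym oner_eq0.
exists (c / ph), (fun k => pauli1 (a 0 k) (b 0 k)); split.
- by rewrite -expr4_eq1 expr_div_n c4 ph4 divr1.
- by move=> k; rewrite /pauli1; do 2!case: ifP => _; rewrite !inE eqxx ?orbT.
- by rewrite T pauli_scale divfK.
Qed.

End Monomial.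

(** * Clifford conjugation and the Lagrangian subspace of a semi-Clifford gate *)

Section SemiClifford.
Variables (C : numClosedFieldType) (n : nat).
Implicit Types (a b v w z : bits n) (U : operator C n).

Lemma conj_mulmx U (A B : operator C n) : U \is unitarymx ->
  U *m A *m U ^t* *m (U *m B *m U ^t* ) = U *m (A *m B) *m U ^t*.
Proof.
move=> /unitarymxP /mulmx1C UU.
by rewrite !mulmxA -[in LHS](mulmxA (U *m A)) UU mulmx1.
Qed.

Lemma conj_mulmx_inj U : U \is unitarymx ->
  injective (fun A : operator C n => U *m A *m U ^t*).
Proof.
move=> /unitarymxP /mulmx1C UU A B /(congr1 (fun M => U ^t* *m M *m U)).
by rewrite !mulmxA UU !mul1mx -!mulmxA UU !mulmx1.
Qed.

Lemma clifford_pauli U a b : clifford U ->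
  exists c ab, c != 0 /\ U *m pauli 1 a b *m U ^t* = pauli c ab.1 ab.2.
Proof.
case=> _ /(_ (pauli 1 a b)) cU.
have /cU/pauli_groupP[c [a' [b' [c4 ->]]]] : pauli_group (pauli (1 : C) a b).
  by apply/pauli_groupP; exists 1, a, b; rewrite expr1n.
exists c, (a', b'); split=> //.
by apply: contra_eq_neq c4 => ->; rewrite expr0n eq_sym oner_eq0.
Qed.

(** Modulo phases, conjugation by [U] is an injective self-map of the finite set of labels [(a, b)],
    hence onto. *)
Lemma clifford_pauli_surj U a b : clifford U ->
  exists ab c, c != 0 /\ U *m pauli 1 ab.1 ab.2 *m U ^t* = pauli c a b.
Proof.
move=> cU; have uU : U \is unitarymx by case: cU.
have /fin_all_exists[F FP] (ab : bits n * bits n) :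
    exists ab', exists c, c != 0 /\ U *m pauli 1 ab.1 ab.2 *m U ^t* = pauli c ab'.1 ab'.2.
  by have [c [ab' H]] := clifford_pauli ab.1 ab.2 cU; exists ab', c.
have F_inj : injective F.
  move=> x y Fxy; have [c [c0 ex]] := FP x; have [d [d0 ey]] := FP y.
  (* Equal labels make the two conjugates proportional with ratio [c / d], and conjugation is
     injective. *)
  have : U *m pauli (c / d) y.1 y.2 *m U ^t* = U *m pauli 1 x.1 x.2 *m U ^t*.
    rewrite ex Fxy -[c / d]mulr1 -pauli_scale -scalemxAr -scalemxAl ey.
    by rewrite pauli_scale divfK.
  move/(conj_mulmx_inj uU)/pauli_inj => [|_ e1 e2]; first by rewrite mulf_neq0 ?invr_neq0.
  by case: x y e1 e2 {Fxy ex ey} => [? ?] [? ?] /= -> ->.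
have [G _ GK] := injF_bij F_inj.
by have [c] := FP (G (a, b)); rewrite GK => H; exists (G (a, b)), c.
Qed.

(** Up to sign, conjugation sends X^a to X^(aG) and Z^b to Z^b' with b' the image of b under the
    inverse transpose of [G]; the translation only affects the sign. *)
Lemma affine_clifford (G : 'M_n) (c : bits n) : G \in unitmx ->
  clifford_permutation (basis_map C (fun v => v *m G + c)).
Proof.
move=> uG; set f := fun v => _; pose g w := (w - c) *m invmx G.
have fK : cancel f g by move=> v; rewrite /g /f addrK mulmxK.
have gK : cancel g f by move=> v; rewrite /g /f mulmxKV ?subrK.
have pf := basis_map_perm C fK gK.
split=> //; split=> [|P /pauli_groupP[k [a [b [k4 ->]]]]]; first by case: pf.
apply/pauli_groupP; exists (k * sgn C (dot b (g 0))), (a *m G), (b *m (invmx G)^T).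
rewrite exprMn sgn_expr4 k4 mulr1; split=> //.
rewrite (basis_map_adj C fK gK) !basis_mapE /pauli !wmap_mul.
apply: eq_wmap => w /=.
  by rewrite /f mulmxDl addrAC -/(f (g w)) gK.
rewrite mul1r mulr1 dot_mull trmxK -mulrA -sgnD -dotDr; congr (_ * sgn _ (dot _ _)).
by rewrite -mulmxDl sub0r addrC.
Qed.

Lemma additive_mx (al : bits n -> bits n) : (forall x y, al (x + y) = al x + al y) ->
  exists M : 'M_n, forall z, al z = z *m M.
Proof.
move=> alD; have al0 : al 0 = 0 by apply: (addrI (al 0)); rewrite -alD !addr0.
exists (\matrix_(i, j) al (delta_mx 0 i) 0 j) => z.
rewrite {1}[z]row_sum_delta (big_morph al alD al0) mulmx_sum_row.
apply: eq_bigr => i _; rewrite (_ : row i _ = al (delta_mx 0 i)).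
  by case: (F2_cases (z 0 i)) => ->; rewrite ?scale0r ?scale1r.
by apply/rowP => j; rewrite !mxE.
Qed.

(* Modulo phases, the Paulis that U conjugates to Z-type ones form a Lagrangian
   subspace, with elements (a, b) = (z *m alpha, z *m beta).  The last clause is
   its maximality, of which only the X part is kept. *)
Lemma clifford_lagrangian U : clifford U ->
  exists alpha beta : 'M['F_2]_n,
    (forall z, exists c, c != 0 /\
       U *m pauli 1 (z *m alpha) (z *m beta) *m U ^t* = pauli c 0 z) /\
    (forall a b, (forall z, dot a (z *m beta) = dot b (z *m alpha)) ->
       exists z, a = z *m alpha).
Proof.
move=> cU; have uU : U \is unitarymx by case: cU.
have /fin_all_exists[L LP] z := clifford_pauli_surj 0 z cU.
have LD x y : L (x + y) = L x + L y.
  have [c [c0 ex]] := LP x; have [d [d0 ey]] := LP y.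
  have [e [e0 exy]] := LP (x + y).
  (* Both sides are conjugated to the same multiple of Z^(x + y); [c * d / e] is the ratio of the
     phases. *)
  have : U *m pauli (c * d / e) (L (x + y)).1 (L (x + y)).2 *m U ^t*
       = U *m (pauli 1 (L x).1 (L x).2 *m pauli 1 (L y).1 (L y).2) *m U ^t*.
    rewrite -[c * d / e]mulr1 -pauli_scale -scalemxAr -scalemxAl exy.
    rewrite -conj_mulmx // ex ey pauli_mul pauli_scale divfK // dot0r sgn0 mulr1.
    by rewrite addr0.
  move/(conj_mulmx_inj uU); rewrite pauli_mul => /pauli_inj[|_ e1 e2].
    by rewrite !mulf_neq0 ?invr_neq0.
  by rewrite [L (x + y)]surjective_pairing e1 e2.
have [|alpha aE] := @additive_mx (fun z => (L z).1); first by move=> x y; rewrite LD.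
have [|beta bE] := @additive_mx (fun z => (L z).2); first by move=> x y; rewrite LD.
exists alpha, beta; split=> [z|a b abL]; first by rewrite -aE -bE; apply: LP.
have [c [[a' z]/= [c0 eQ]]] := clifford_pauli a b cU.
(* X^a Z^b commutes with every element of the subspace, so its image commutes with every Z^x and has
   no X part. *)
have a'0 : a' = 0.
  apply: dot_inj => x; rewrite dot0l dotC; have [d [d0 ex]] := LP x.
  have : U *m (pauli 1 a b *m pauli 1 (L x).1 (L x).2) *m U ^t*
       = U *m (pauli 1 (L x).1 (L x).2 *m pauli 1 a b) *m U ^t*.
    rewrite !pauli_mul aE bE (dotC _ a) abL; congr (_ *m pauli _ _ _ *m _); exact: addrC.
  rewrite -!conj_mulmx // ex eQ !pauli_mul dot0r sgn0 mulr1.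
  move=> /pauli_inj[|]; first by rewrite mulf_neq0.
  rewrite (mulrC d) => + _ _; rewrite -{1}[c * d]mulr1 => /mulfI; rewrite mulf_neq0 //.
  by move/(_ isT); rewrite -(sgn0 C) => /sgn_inj <-.
(* This image and that of [L z] are both multiples of Z^z, so [a] is the X part of [L z]. *)
have [d [d0 ez]] := LP z; exists z; rewrite -aE.
have : U *m pauli (c / d) (L z).1 (L z).2 *m U ^t* = U *m pauli 1 a b *m U ^t*.
  rewrite eQ a'0 -[c / d]mulr1 -pauli_scale -scalemxAr -scalemxAl ez.
  by rewrite pauli_scale divfK.
by move/(conj_mulmx_inj uU)/pauli_inj => [|//]; rewrite mulf_neq0 ?invr_neq0.
Qed.

(** [phi2] carries the subspace to Z-type Paulis, which commute with [d], and [phi1] carries these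
    to Paulis again. The permutation part of the resulting identity gives the first clause, its
    weights the second. *)
Lemma semi_clifford_lagrangian (f g : bits n -> bits n) :
  cancel f g -> cancel g f -> semi_clifford (basis_map C f) ->
  exists alpha beta : 'M['F_2]_n,
    [/\ forall z, exists a', forall v, f (v + z *m alpha) = f v + a',
        forall z, exists bc, forall v, dot (z *m beta) v = dot bc.1 (f v) + bc.2
      & forall a b, (forall z, dot a (z *m beta) = dot b (z *m alpha)) ->
          exists z, a = z *m alpha].
Proof.
move=> fK gK [phi1 [d [phi2 [c1 [ud /diag_mxP[D dD]] c2 fE]]]].
have [alpha [beta [LP Lmax]]] := clifford_lagrangian c2.
suff H z : exists c a' b', pauli c a' b' =
    basis_map C f *m pauli 1 (z *m alpha) (z *m beta) *m (basis_map C f)^t*.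
  exists alpha, beta; split=> // z.
    have [c [a' [b']]] := H z.
    rewrite (basis_map_adj C fK gK) !basis_mapE !wmap_mul => /esym/wmap_inj[w|e _].
      by rewrite mul1r mulr1 mul1r sgn_neq0.
    by exists a' => v; move: (e (f v)); rewrite /= fK.
  have [c [a' [b']]] := H z.
  rewrite (basis_map_adj C fK gK) !basis_mapE !wmap_mul => /esym/wmap_inj[w|_ e].
    by rewrite mul1r mulr1 mul1r sgn_neq0.
  (* At 0 the identity of weights shows that the phase [c] is the sign of [dot (z *m beta) (g 0)],
     whence the additive constant. *)
  exists (b', dot (z *m beta) (g 0)) => v /=; apply: (@sgn_inj C).
  move: (e 0) (e (f v)); rewrite /= fK !mul1r !mulr1 dot0r sgn0 mulr1 sgnD => <- ->.
  exact: mulrC.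
have [c [c0 cE]] := LP z.
have [k [[a' b'] [k0 kE]]] := clifford_pauli 0 z c1.
exists (c * k), a', b'; rewrite -pauli_scale -kE fE.
rewrite !trmx_mul !map_mxM /=.
have dZ : d *m pauli 1 0 z = pauli 1 0 z *m d.
  have [E ->] : exists E, pauli (1 : C) 0 z = diag_mx E.
    exists (\row_i sgn C (dot z (enum_val i))); apply/matrixP => i j.
    rewrite !mxE addr0 mul1r (inj_eq enum_val_inj).
    by case: eqP => [->|_]; rewrite ?mul1r ?mul0r.
  by rewrite dD diag_mxC.
transitivity (phi1 *m (d *m (phi2 *m pauli 1 (z *m alpha) (z *m beta) *m phi2 ^t* )
  *m d ^t* ) *m phi1 ^t* ); last by rewrite !mulmxA.
rewrite cE -[c]mulr1 -pauli_scale -scalemxAr -scalemxAl -scalemxAr -scalemxAl.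
by rewrite mulr1 dZ -(mulmxA _ d) (unitarymxP ud) mulmx1.
Qed.

End SemiClifford.

(** * Shears as mismatch-free circuits *)

Section Circuits.
Variables (C : numClosedFieldType) (n : nat).
Implicit Types (u v w : bits n) (S K : {set 'I_n}) (s : seq ('I_n * {set 'I_n})).

Lemma algebraic_normal_form (p : bits n -> 'F_2) S :
  (forall u v, {in S, forall i, u 0 i = v 0 i} -> p u = p v) ->
  exists c : {set 'I_n} -> 'F_2,
    forall u, p u = \sum_(K : {set 'I_n} | K \subset S) c K * \prod_(i in K) u 0 i.
Proof.
move=> pS.
(* Expand, by distributivity, the indicator of {r} in the sum of p w over w,
   where r is u with the coordinates outside S set to 0. *)
exists (fun K => \sum_(w : bits n) (\prod_(i in ~: K) (w 0 i + 1)) * p w) => u.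
have [r rE] : exists r : bits n, forall i, r 0 i = if i \in S then u 0 i else 0.
  by exists (\row_i (if i \in S then u 0 i else 0)) => i; rewrite mxE.
have -> : p u = p r by apply: pS => i iS; rewrite rE iS.
have -> : p r = \sum_(w : bits n) (\prod_i (r 0 i + (w 0 i + 1))) * p w.
  rewrite (bigD1 r) //= big1 => [|i _]; last by rewrite addrA F2_addxx add0r.
  rewrite mul1r big1 ?addr0 // => w wr.
  have /existsP[k rk] : [exists i, w 0 i != r 0 i].
    by apply: contraR wr => /existsPn e; apply/eqP/rowP => i; apply/eqP/negPn.
  rewrite (bigD1 k) //= addrA.
  suff -> : r 0 k + w 0 k + 1 = 0 by rewrite !mul0r.
  move: rk; case: (F2_cases (w 0 k)) => ->;
    by case: (F2_cases (r 0 k)) => -> // _; apply: val_inj.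
have pr w : \prod_i (r 0 i + (w 0 i + 1)) =
    \sum_(K : {set 'I_n} | K \subset S)
      (\prod_(i in K) u 0 i) * \prod_(i in ~: K) (w 0 i + 1).
  rewrite bigA_distr /= (bigID (fun K : {set 'I_n} => K \subset S)) /=.
  rewrite [X in _ + X]big1 ?addr0.
    apply: eq_bigr => K KS; rewrite (bigID (fun i => i \in K)) /=; congr (_ * _).
      by apply: eq_bigr => i iK; rewrite iK rE (subsetP KS).
    by apply: eq_big => i; [rewrite inE | move/negPf ->].
  move=> K /subsetPn[k kK /negPf kS].
  by rewrite (bigD1 k) //= kK rE kS mul0r.
under eq_bigr => w _ do rewrite pr big_distrl.
rewrite exchange_big /=; apply: eq_bigr => K _; rewrite big_distrl.
by apply: eq_bigr => w _; rewrite /= -mulrA mulrC.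
Qed.

Lemma mcx_funE t K u : mcx_fun t K u = u + (\prod_(i in K) u 0 i) *: delta_mx 0 t.
Proof.
by apply/rowP => j; rewrite !mxE eqxx /=; case: eqP => _; rewrite ?mulr1 ?mulr0 ?addr0.
Qed.

(** Targets lie outside [S] and controls inside, so no gate changes a control value and the
    increments add up. *)
Lemma mcx_circuitE S s :
  (forall g, g \in s -> g.1 \notin S /\ g.2 \subset S) ->
  \big[mulmx/1%:M]_(g <- s) mcx C g.1 g.2
  = basis_map C (fun u => u + \sum_(g <- s) (\prod_(i in g.2) u 0 i) *: delta_mx 0 g.1).
Proof.
elim: s => [|g s IH] sS.
  rewrite big_nil basis_mapE -wmap1; apply: eq_wmap => // u.
  by rewrite big_nil addr0.
rewrite big_cons IH => [|h hs]; last by apply: sS; rewrite inE hs orbT.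
rewrite /mcx basis_map_comp !basis_mapE; apply: eq_wmap => // u /=.
rewrite mcx_funE big_cons -addrA [in LHS](addrC (\sum_(_ <- _) _)).
congr (_ + (_ *: _ + _)); apply: eq_bigr => i ig.
rewrite mxE summxE big_seq big1 ?addr0 // => h hs; rewrite !mxE eqxx /=.
have [hS _] : h.1 \notin S /\ h.2 \subset S by apply: sS; rewrite inE hs orbT.
have [_ /subsetP gS] : g.1 \notin S /\ g.2 \subset S by apply: sS; rewrite mem_head.
by case: eqP => [e|_]; rewrite ?mulr0 //; move: hS; rewrite -e gS.
Qed.

(** Each monomial with coefficient 1 in the algebraic normal form of coordinate [t] of [h], for [t]
    outside [S], becomes one gate with target [t]. *)
Lemma shear_mismatch_free (h : bits n -> bits n) S :
  (forall u, {in S, forall i, h u 0 i = 0}) ->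
  (forall u v, {in S, forall i, u 0 i = v 0 i} -> h u = h v) ->
  mismatch_free_product (basis_map C (fun u => u + h u)).
Proof.
move=> h0 hS.
have /fin_all_exists[c cE] (t : 'I_n) := algebraic_normal_form
  (p := fun u => h u 0 t) (fun u v uv => congr1 (fun w : bits n => w 0 t) (hS u v uv)).
pose s := enum [set g : 'I_n * {set 'I_n} |
  [&& g.1 \notin S, g.2 \subset S & c g.1 g.2 == 1]].
have sS g : g \in s -> g.1 \notin S /\ g.2 \subset S.
  by rewrite mem_enum inE => /and3P[].
exists s; split.
- by move=> g /sS[gS /subsetP sub]; apply: contra gS; apply: sub.
- by move=> g g' /sS[gS _] /sS[_ /subsetP sub]; apply: contra gS; apply: sub.
rewrite (mcx_circuitE sS) !basis_mapE; apply: eq_wmap => // u; congr (_ + _).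
apply/rowP => j; rewrite summxE big_enum /=.
under eq_bigr => g _ do rewrite !mxE eqxx /=.
have [jS|jS] := boolP (j \in S).
  rewrite h0 // big1 // => g; rewrite inE => /and3P[gS _ _].
  by case: eqP => [e|_]; rewrite ?mulr0 //; move: gS; rewrite -e jS.
rewrite cE.
rewrite (bigID (fun g => g.1 == j)) /= [X in _ + X]big1 ?addr0; last first.
  by move=> g /andP[_ /negPf]; rewrite eq_sym => ->; rewrite mulr0.
rewrite [RHS](eq_bigl (fun g : 'I_n * {set 'I_n} =>
  (g.1 == j) && ((g.2 \subset S) && (c j g.2 == 1)))).
  rewrite -(pair_big (fun t => t == j) (fun K => (K \subset S) && (c j K == 1))
    (fun t K => (\prod_(i in K) u 0 i) * (j == t)%:R)) /=.
  rewrite big_pred1_eq [RHS]big_mkcondr /=; apply: eq_bigr => K _.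
  by rewrite eqxx mulr1; case: (F2_cases (c j K)) => ->; rewrite ?mul0r ?mul1r.
by case=> t K; rewrite inE /= andbC; case: eqP => //= ->; rewrite jS.
Qed.

End Circuits.

(** * Linear coordinates in which the permutation is a shear *)

Section NormalForm.
Variables (C : numClosedFieldType) (n : nat).
Implicit Types (a b u v w z : bits n) (f F h : bits n -> bits n).


(** [B1] and [B2] hold the linear forms that [f] matches up to constants; the last clause comes from
    the maximality of the Lagrangian subspace. *)
Lemma semi_clifford_coordinates f g :
  cancel f g -> cancel g f -> semi_clifford (basis_map C f) ->
  exists k (B1 B2 : 'M['F_2]_(k, n)) (c : 'rV_k),
    [/\ row_free B1, row_free B2,
        forall v, v *m B1^T = f v *m B2^T + c
      & forall a, a *m B1^T = 0 -> exists a', forall v, f (v + a) = f v + a'].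
Proof.
move=> fK gK scf.
have [alpha [beta [fX fZ Lmax]]] := semi_clifford_lagrangian fK gK scf.
(* The rows of B0 span the b such that (0, b) is in the Lagrangian subspace. *)
pose B0 := kermx alpha *m beta; pose B1 := row_base B0.
have B1L i : exists z, row i B1 = z *m beta.
  have /submxP[D ->] : (row i B1 <= B0)%MS.
    by apply: submx_trans (row_sub i B1) _; rewrite eq_row_base.
  by exists (D *m kermx alpha); rewrite mulmxA.
have /fin_all_exists[bc bcE] i :
    exists bc, forall v, dot (row i B1) v = dot bc.1 (f v) + bc.2.
  by have [z ->] := B1L i; apply: fZ.
pose B2 := \matrix_i (bc i).1; pose c := \row_i (bc i).2.
have mulB (m : nat) (v : bits n) (M : 'M_(m, n)) i : (v *m M^T) 0 i = dot (row i M) v.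
  by rewrite dotC /dot !mxE; apply: eq_bigr => j _; rewrite !mxE.
have E v : v *m B1^T = f v *m B2^T + c.
  by apply/rowP => i; rewrite [RHS]mxE !mulB bcE rowK [c 0 i]mxE.
exists (\rank B0), B1, B2, c; split=> // [||a aB1].
- exact: row_base_free.
(* If [w] kills [B2], the linear form [w *m B1] is constant, hence equal to its value 0 at 0. *)
- apply: inj_row_free => w wB2.
  have B1w v : v *m B1^T *m w^T = c *m w^T.
    by rewrite E mulmxDl -mulmxA -trmx_mul wB2 trmx0 mulmx0 add0r.
  have wB1 : w *m B1 = 0.
    apply: dot_inj => v; rewrite dot0l dotC /dot trmx_mul mulmxA B1w.
    by rewrite -(B1w 0) !mul0mx mxE.
  by apply: (row_free_inj (row_base_free B0)); rewrite mul0mx.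
have aB0 : a *m B0^T = 0.
  have /submxP[D ->] : (B0 <= B1)%MS by rewrite eq_row_base.
  by rewrite trmx_mul mulmxA aB1 mul0mx.
(* The row space of [alpha^T] is the annihilator of the left kernel of [alpha], and [aB0] says that
   [a *m beta^T] lies in it. The resulting [b] makes X^a Z^b commute with the whole subspace. *)
have /submxP[b bE] : (a *m beta^T <= alpha^T)%MS.
  rewrite submxE; have /submxP[D DE] : ((cokermx alpha^T)^T <= kermx alpha)%MS.
    by apply/sub_kermxP; apply: trmx_inj; rewrite trmx_mul trmxK mulmx_coker trmx0.
  by rewrite -[cokermx _]trmxK DE trmx_mul !mulmxA -(mulmxA a) -trmx_mul aB0 mul0mx.
have [z ->] : exists z, a = z *m alpha; last exact: fX.
apply: (Lmax a b) => z.
by rewrite /dot !trmx_mul !mulmxA bE.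
Qed.

(** Completes the rows of [B] to a basis, so that [B] reads off the first [k] coordinates after a
    linear change of variables. *)
Lemma row_free_pid_mx k (B : 'M['F_2]_(k, n)) : row_free B ->
  exists2 G, G \in unitmx & B = pid_mx k *m G.
Proof.
move=> fB; have kn : (k <= n)%N by rewrite -(eqP fB) rank_leq_col.
(* Padding [B] with zero rows gives the square matrix that [complete_unitmx] takes. *)
have BE : (pid_mx k : 'M_(k, n)) *m ((pid_mx k : 'M_(n, k)) *m B) = B.
  by rewrite mulmxA mul_pid_mx minnn (minn_idPr kn) pid_mx_1 mul1mx.
have [|G uG GE] := @complete_unitmx _ k n (pid_mx k) ((pid_mx k : 'M_(n, k)) *m B).
  by rewrite BE (eqP fB) rank_pid_mx.
by exists G; rewrite // -GE BE.
Qed.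

(** The projector [rho] splits [u] into x = [u *m rho] and a complement y. [F] fixes x and is affine
    in y, with a linear part that does not depend on x. Thus [T], the identity on x and this linear
    part on y, reduces [F] to a shear. *)
Lemma shear_normal_form F (rho : 'M['F_2]_n) :
  injective F -> rho *m rho = rho -> (forall u, F u *m rho = u *m rho) ->
  (forall a, a *m rho = 0 -> exists a', forall v, F (v + a) = F v + a') ->
  exists T h, [/\ T \in unitmx, forall u, h u *m rho = 0
    & forall u, F u = (u + h (u *m rho)) *m T].
Proof.
move=> F_inj rr Fr Fa; pose r' := 1%:M - rho.
have r'r : r' *m rho = 0 by rewrite mulmxBl mul1mx rr subrr.
have rr' : rho *m r' = 0 by rewrite mulmxBr mulmx1 rr subrr.
pose tau a := F (a *m r') - F 0.
have FD v a : F (v + a *m r') = F v + tau a.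
  have [|a' a'E] := Fa (a *m r'); first by rewrite -mulmxA r'r mulmx0.
  by rewrite a'E /tau -[a *m r']add0r a'E addrAC subrr add0r.
have [|N NE] := @additive_mx n tau.
  move=> x y; apply: (addrI (F 0)).
  by rewrite [RHS]addrA -!FD mulmxDl addrA.
have rN : rho *m N = 0.
  apply/row_matrixP => i; rewrite row0 row_mul -NE /tau.
  by rewrite -row_mul rr' row0 subrr.
have Nr : N *m rho = 0.
  apply/row_matrixP => i; rewrite row0 row_mul rowE -NE /tau.
  by rewrite mulmxBl !Fr mul0mx subr0 -mulmxA r'r mulmx0.
pose T := rho + N.
have Tr : T *m rho = rho by rewrite mulmxDl rr Nr addr0.
(* A vector [a] killed by [T] has zero x part, and then [F a = F 0]. *)
have uT : T \in unitmx.
  rewrite -row_free_unit; apply: inj_row_free => a aT.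
  have ar : a *m rho = 0 by rewrite -Tr mulmxA aT mul0mx.
  have aN : tau a = 0 by rewrite NE -aT mulmxDr ar add0r.
  have /F_inj : F (a *m r') = F 0 by apply/eqP; rewrite -subr_eq0; apply/eqP.
  by rewrite mulmxBr mulmx1 ar subr0.
(* The shear is the y part of [F x] pulled back by [T]; as [T] preserves x parts, it has no x
   part. *)
exists T, (fun x => F x *m r' *m invmx T); split=> // u.
  by rewrite -Tr -(mulmxA _ (invmx T)) mulKmx // -mulmxA r'r mulmx0.
rewrite mulmxDl mulmxKV //.
have -> : F u = F (u *m rho) + u *m N.
  by rewrite -NE -FD -mulmxDr addrC subrK mulmx1.
rewrite mulmxDr mulmxBr mulmx1 Fr -(mulmxA u) rr.
by rewrite [RHS]addrC addrA subrK.
Qed.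

End NormalForm.

(** * Assembling the two affine gates and the shear *)

Theorem theoremB2 (R : realType) (n : nat) (pi : operator R[i] n) :
  permutation_gate pi -> semi_clifford pi ->
  exists phi1 mu phi2 : operator R[i] n,
    [/\ clifford_permutation phi1, mismatch_free_product mu,
        clifford_permutation phi2
      & pi = (phi1 *m mu *m phi2)%R].
Proof.
move=> /permutation_gateP[f [g [fK gK ->]]] scf.
have [k [B1 [B2 [c [fB1 fB2 B12 fX]]]]] := semi_clifford_coordinates fK gK scf.
have kn : (k <= n)%N by rewrite -(eqP fB1) rank_leq_col.
have [G1 uG1 B1E] := row_free_pid_mx fB1; have [G2 uG2 B2E] := row_free_pid_mx fB2.
pose J : 'M['F_2]_(k, n) := pid_mx k; pose rho : 'M['F_2]_n := pid_mx k.
have rhoE : rho = J^T *m J by rewrite tr_pid_mx mul_pid_mx !minnn.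
have JJ : J *m J^T = 1%:M by rewrite tr_pid_mx mul_pid_mx !minnn (minn_idPr kn) pid_mx_1.
have uG1T : G1^T \in unitmx by rewrite unitmx_tr.
have uG2T : G2^T \in unitmx by rewrite unitmx_tr.
(* [F] is [f] in coordinates where the forms in [B1] and [B2] are the first [k] ones; [c *m J]
   absorbs the constants, so that [F] fixes these coordinates. *)
pose F u := f (u *m invmx G1^T) *m G2^T + c *m J.
have F_inj : injective F.
  move=> u v /addIr/(can_inj (mulmxK uG2T))/(can_inj fK).
  exact: (can_inj (mulmxKV uG1T)).
have Fr u : F u *m rho = u *m rho.
  rewrite rhoE !mulmxA; congr (_ *m J).
  rewrite mulmxDl -(mulmxA c) JJ mulmx1 -mulmxA -trmx_mul -B2E -B12.
  by rewrite B1E trmx_mul mulmxA mulmxKV.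
have Fa a : a *m rho = 0 -> exists a', forall v, F (v + a) = F v + a'.
  move=> ar; have [|a' a'E] := fX (a *m invmx G1^T).
    rewrite B1E trmx_mul mulmxA mulmxKV //.
    by rewrite -[_^T]mulmx1 -JJ (mulmxA J^T) -rhoE mulmxA ar mul0mx.
  exists (a' *m G2^T) => v.
  by rewrite /F mulmxDl a'E mulmxDl addrAC.
have rr : rho *m rho = rho by rewrite mul_pid_mx !minnn (minn_idPr kn).
have [T [h [uT hr FE]]] := shear_normal_form F_inj rr Fr Fa.
have rhoP (u : bits n) i : (u *m rho) 0 i = if (i < k)%N then u 0 i else 0.
  rewrite mxE (bigD1 i) //= big1 ?addr0 => [|j /negPf ji].
    by rewrite mxE eqxx /=; case: ifP => _; rewrite ?mulr1 ?mulr0.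
  by rewrite mxE -val_eqE in ji *; rewrite ji mulr0.
(* The left factor applies [T], then undoes the affine change of output coordinates built into
   [F]. *)
exists (basis_map _ (fun w => w *m (T *m invmx G2^T) + - (c *m J *m invmx G2^T))).
exists (basis_map _ (fun u => u + h (u *m rho))).
exists (basis_map _ (fun v => v *m G1^T + 0)); split.
- by apply: affine_clifford; rewrite unitmx_mul uT unitmx_inv.
- apply: (@shear_mismatch_free _ _ (fun u => h (u *m rho)) [set i : 'I_n | (i < k)%N])
    => [u i|u v uv].
    by rewrite inE => ik; have := rhoP (h (u *m rho)) i; rewrite ik hr mxE.
  congr h; apply/rowP => i; rewrite !rhoP; case: ifP => // ik.
  by apply: uv; rewrite inE.
- exact: affine_clifford.
rewrite !basis_map_comp !basis_mapE; apply: eq_wmap => // v /=.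
rewrite addr0 mulmxA -FE -mulmxBl /F addrK mulmxK //.
by rewrite mulmxK.
Qed.
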